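(* As formal power series in $x,y$, $$\sum_{n=0}^{\infty}\sum_{k=0}^{\infty}D_{n,k}\frac{x^n}{n!}\frac{y^k}{k!}=\frac{1}{e^x+e^y-e^{x+y}}.$$
   Context: A $01$ matrix is lonesum if it is uniquely determined among $01$ matrices of its size by its row sum vector and column sum vector; equivalently (Ryser), no $2\times 2$ submatrix (obtained by deleting rows and columns) equals $\begin{pmatrix}1&0\\0&1\end{pmatrix}$ or $\begin{pmatrix}0&1\\1&0\end{pmatrix}$. Empty matrices (with $0$ rows or $0$ columns) count as lonesum. $D_{n,k}$ is the number of lonesum $01$ matrices of size $n\times k$ in which every column and every row contains at least one $1$; in particular $D_{0,0}=1$ and $D_{n,0}=D_{0,n}=0$ for $n\ge1$. *)

(* Defs.v *)
From HB Require Import structures.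
From mathcomp Require Import all_boot all_order all_algebra.
From mathcomp Require Import boolp.

Set Implicit Arguments.
Unset Strict Implicit.
Unset Printing Implicit Defensive.

Import GRing.Theory.
Local Open Scope ring_scope.

Record fps (R : Type) := Fps { coefs : nat -> R }.

HB.instance Definition _ (R : Type) := gen_eqMixin (fps R).
HB.instance Definition _ (R : Type) := gen_choiceMixin (fps R).

Lemma fpsP (R : Type) (f g : fps R) : coefs f =1 coefs g -> f = g.
Proof. by case: f g => [f] [g] /= /funext ->. Qed.

Section FpsZmod.
Variable R : zmodType.
Implicit Types f g h : fps R.

Definition fps_zero : fps R := Fps (fun=> 0).
Definition fps_opp f : fps R := Fps (fun n => - coefs f n).
Definition fps_add f g : fps R := Fps (fun n => coefs f n + coefs g n).

Fact fps_addA : associative fps_add.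
Proof. by move=> f g h; apply: fpsP => n /=; rewrite addrA. Qed.
Fact fps_addC : commutative fps_add.
Proof. by move=> f g; apply: fpsP => n /=; rewrite addrC. Qed.
Fact fps_add0 : left_id fps_zero fps_add.
Proof. by move=> f; apply: fpsP => n /=; rewrite add0r. Qed.
Fact fps_addN : left_inverse fps_zero fps_opp fps_add.
Proof. by move=> f; apply: fpsP => n /=; rewrite addNr. Qed.

HB.instance Definition _ :=
  GRing.isZmodule.Build (fps R) fps_addA fps_addC fps_add0 fps_addN.

End FpsZmod.

Section FpsRing.
Variable R : comNzRingType.
Implicit Types f g h : fps R.

Definition fps_one : fps R := Fps (fun n => (n == 0%N)%:R).
Definition fps_mul f g : fps R :=
  Fps (fun n => \sum_(i < n.+1) coefs f i * coefs g (n - i)%N).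

Let trunc m f : {poly R} := \poly_(i < m) coefs f i.

Let coef_fps_mul m n f g : (n < m)%N ->
  coefs (fps_mul f g) n = (trunc m f * trunc m g)`_n.
Proof.
move=> lt_nm; rewrite coefM /=; apply: eq_bigr => i _; rewrite !coef_poly.
have -> : (i < m)%N by apply: leq_trans lt_nm; apply: ltn_ord.
by have -> : (n - i < m)%N by apply: leq_ltn_trans lt_nm; apply: leq_subr.
Qed.

Fact fps_mulA : associative fps_mul.
Proof.
move=> f g h; apply: fpsP => n; rewrite !(@coef_fps_mul n.+1) //.
transitivity (trunc n.+1 f * (trunc n.+1 g * trunc n.+1 h))`_n.
  rewrite !coefM; apply: eq_bigr => i _; congr (_ * _).
  have lt_i : (n - i < n.+1)%N by rewrite ltnS leq_subr.
  by rewrite [LHS]coef_poly lt_i (@coef_fps_mul n.+1).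
rewrite mulrA !coefM; apply: eq_bigr => i _; congr (_ * _).
by rewrite [RHS]coef_poly ltn_ord (@coef_fps_mul n.+1) // coefM.
Qed.

Fact fps_mulC : commutative fps_mul.
Proof.
by move=> f g; apply: fpsP => n; rewrite !(@coef_fps_mul n.+1) // mulrC.
Qed.

Fact fps_mul1 : left_id fps_one fps_mul.
Proof.
move=> f; apply: fpsP => n /=.
by rewrite big_ord_recl subn0 mul1r big1 ?addr0 // => i _; rewrite mul0r.
Qed.

Fact fps_mulDl : left_distributive fps_mul (@fps_add R).
Proof.
move=> f g h; apply: fpsP => n /=.
by rewrite -big_split; apply: eq_bigr => i _; rewrite mulrDl.
Qed.

Fact fps_one_neq0 : fps_one != 0.
Proof.
by apply/eqP => /(congr1 (fun f => coefs f 0)) /eqP; rewrite /= oner_eq0.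
Qed.

HB.instance Definition _ := GRing.Zmodule_isComNzRing.Build (fps R)
  fps_mulA fps_mulC fps_mul1 fps_mulDl fps_one_neq0.

Definition fps_unit : {pred fps R} := fun f => `[< exists g, g * f = 1 >].

Definition fps_inv f : fps R :=
  if pselect (exists g, g * f = 1) is left inv_f then projT1 (cid inv_f) else f.

Fact fps_mulVf : {in fps_unit, left_inverse 1 fps_inv *%R}.
Proof.
move=> f /asboolP f_unit; rewrite /fps_inv; case: pselect => // ?.
by case: cid.
Qed.
Fact fps_unitPl f g : g * f = 1 -> fps_unit f.
Proof. by move=> gf1; apply/asboolP; exists g. Qed.
Fact fps_inv_out : {in [predC fps_unit], fps_inv =1 id}.
Proof.
by move=> f /asboolP f_nunit; rewrite /fps_inv; case: pselect.
Qed.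

HB.instance Definition _ := GRing.ComNzRing_hasMulInverse.Build (fps R)
  fps_mulVf fps_unitPl fps_inv_out.

Lemma coef_fpsM f g n :
  coefs (f * g) n = \sum_(i < n.+1) coefs f i * coefs g (n - i)%N.
Proof. by []. Qed.

End FpsRing.

Lemma fps_unitE (R : comUnitRingType) (f : fps R) :
  (f \is a GRing.unit) = (coefs f 0 \is a GRing.unit).
Proof.
apply/idP/idP => [f_unit|f0_unit].
  have /(congr1 (fun h => coefs h 0)) := mulVr f_unit.
  rewrite coef_fpsM big_ord1 => /= gf1.
  by apply/unitrPr; exists (coefs f^-1 0); rewrite mulrC.
pose next s := - (coefs f 0)^-1 *
  \sum_(i < size s) coefs f i.+1 * nth 0 s (size s - i.+1)%N.
pose pre n := iter n (fun s => rcons s (next s)) [:: (coefs f 0)^-1].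
pose g n := nth 0 (pre n) n.
have size_pre n : size (pre n) = n.+1.
  by elim: n => //= n IHn; rewrite size_rcons IHn.
have preE m n : (m <= n)%N -> nth 0 (pre n) m = g m.
  elim: n => [|n IHn]; first by rewrite leqn0 => /eqP ->.
  rewrite leq_eqVlt => /predU1P[-> //|lt_mn].
  by rewrite /= nth_rcons size_pre lt_mn IHn.
have gS n : g n.+1 =
    - (coefs f 0)^-1 * \sum_(i < n.+1) coefs f i.+1 * g (n - i)%N.
  rewrite /g /= nth_rcons size_pre ltnn eqxx /next size_pre.
  by congr (_ * _); apply: eq_bigr => i _; rewrite subSS preE // leq_subr.
apply/unitrPr; exists (Fps g); apply: fpsP => -[|n].
  by rewrite coef_fpsM big_ord1 /= mulrV.
rewrite coef_fpsM big_ord_recl /= gS mulrA mulrN mulrV // mulN1r.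
by apply/eqP; rewrite addrC subr_eq0; apply/eqP/eq_bigr.
Qed.

(** The coefficient of [x^n y^k] in [F] is [coefs (coefs F n) k]. *)
Notation fps2 := (fps (fps rat)).

Definition fps2_of (a : nat -> nat -> rat) : fps2 :=
  Fps (fun n => Fps (fun k => a n k)).

Definition coef2 (F : fps2) (n k : nat) : rat := coefs (coefs F n) k.

Definition fpsX : fps2 := fps2_of (fun n k => ((n == 1%N) && (k == 0%N))%:R).
Definition fpsY : fps2 := fps2_of (fun n k => ((n == 0%N) && (k == 1%N))%:R).

(** The series [\sum_m F^m / m!], for [F] with zero constant term: then [F^m]
    has no monomial of total degree less than [m], so that only the terms with
    [m <= n + k] contribute to the coefficient of [x^n y^k]. *)
Definition fps_exp (F : fps2) : fps2 :=
  fps2_of (fun n k => \sum_(m < (n + k)%N.+1) coef2 (F ^+ m) n k / m`!%:R).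

Definition egf2 (a : nat -> nat -> nat) : fps2 :=
  fps2_of (fun n k => (a n k)%:R / (n`!%:R * k`!%:R)).

Lemma coef2D F G n k : coef2 (F + G) n k = coef2 F n k + coef2 G n k.
Proof. by []. Qed.

Lemma coef2N F n k : coef2 (- F) n k = - coef2 F n k.
Proof. by []. Qed.

Lemma coef2_1 n k : coef2 1 n k = ((n == 0%N) && (k == 0%N))%:R.
Proof. by case: n. Qed.

Lemma fps2_unitE (F : fps2) : (F \is a GRing.unit) = (coef2 F 0 0 != 0).
Proof. by rewrite !fps_unitE unitfE. Qed.

Lemma coef2_exp00 F : coef2 (fps_exp F) 0 0 = 1.
Proof.
rewrite {1}/coef2 [LHS]/= big_ord1 expr0 coef2_1 [X in X%:R]/= mulr1n.
by rewrite divr1.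
Qed.

(** The inverse of a non-unit is the series itself; this rules out that case
    for the denominator of the generating function. *)
Lemma denominator_unit :
  fps_exp fpsX + fps_exp fpsY - fps_exp (fpsX + fpsY) \is a GRing.unit.
Proof.
have := coef2_exp00 (fpsX + fpsY); have := coef2_exp00 fpsY.
have := coef2_exp00 fpsX.
move: (fps_exp fpsX) (fps_exp fpsY) (fps_exp (fpsX + fpsY)) => F G H F0 G0 H0.
by rewrite fps2_unitE 2!coef2D coef2N F0 G0 H0 addrK oner_neq0.
Qed.

Section Lonesum.
Variables n k : nat.
Implicit Types A B : 'M[bool]_(n, k).

Definition row_sum A (i : 'I_n) : nat := (\sum_j A i j)%N.
Definition col_sum A (j : 'I_k) : nat := (\sum_i A i j)%N.

Definition lonesum A : bool :=
  [forall B : 'M[bool]_(n, k),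
    [forall i, row_sum B i == row_sum A i]
      && [forall j, col_sum B j == col_sum A j] ==> (B == A)].

Definition no_zero_line A : bool :=
  [forall i, exists j, A i j] && [forall j, exists i, A i j].

End Lonesum.

Definition D (n k : nat) : nat :=
  #|[set A : 'M[bool]_(n, k) | lonesum A && no_zero_line A]|.

(* Main.v *)
Require Import Defs.
From mathcomp Require Import all_boot all_order all_algebra.
From mathcomp Require Import perm ring zify.
Set Implicit Arguments.
Unset Strict Implicit.
Unset Printing Implicit Defensive.
Import GRing.Theory.
Local Open Scope ring_scope.

(** Multiplying by the denominator [e^x + e^y - e^(x+y)] turns the identity, at
    the coefficient of [x^n y^k / (n! k!)], into

      sum_i C(n,i) D(i,k) + sum_j C(k,j) D(n,j) - sum_(i,j) C(n,i) C(k,j) D(i,j)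
        = [n = k = 0].

    Deleting the zero rows and zero columns of a 01 matrix neither creates nor
    destroys lonesumness, because a matrix with the same line sums vanishes on
    the same lines. Classifying lonesum matrices by the sets of their nonzero
    rows and columns ([card_lonesum_supp]) therefore shows that the three sums
    count the lonesum [n x k] matrices without zero column, those without zero
    row, and all of them. By inclusion-exclusion, the left-hand side is
    [D(n,k)] minus the number of lonesum matrices that have both a zero row and
    a zero column.

    For [(n,k) <> (0,0)] complementation of all the entries exchanges these two
    families. Indeed the rows of a lonesum matrix form a chain for inclusion, as
    two incomparable rows would contain a 2 x 2 permutation submatrix, which can
    be switched without altering the line sums. The largest row is then the
    union of all the rows, so there is no zero column exactly when some row is
    full ([lonesum_full_row]), that is, when the complement has a zero row; the
    same holds with rows and columns exchanged. For [n = k = 0] the empty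
    matrix is counted by [D] only, whence the constant term 1. *)

(** * Supports and line sums *)

Section Supports.
Variables n k : nat.
Implicit Types A B : 'M[bool]_(n, k).

Definition row_supp A : {set 'I_n} := [set i | [exists j, A i j]].
Definition col_supp A : {set 'I_k} := [set j | [exists i, A i j]].

Lemma no_zero_lineE A :
  no_zero_line A = (row_supp A == [set: _]) && (col_supp A == [set: _]).
Proof.
congr (_ && _).
  apply/forallP/eqP => [h|h i]; first by apply/setP => i; rewrite !inE h.
  by move/setP/(_ i): h; rewrite !inE.
apply/forallP/eqP => [h|h i]; first by apply/setP => i; rewrite !inE h.
by move/setP/(_ i): h; rewrite !inE.
Qed.

(** The supports depend on the line sums only; hence so do the sets of zero
    lines, for all the matrices that compete in the definition of [lonesum]. *)
Lemma row_suppE A i : (i \in row_supp A) = (row_sum A i != 0)%N.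
Proof.
rewrite inE /row_sum sum_nat_eq0 negb_forall.
by apply: eq_existsb => j; case: (A i j).
Qed.

Lemma col_suppE A j : (j \in col_supp A) = (col_sum A j != 0)%N.
Proof.
rewrite inE /col_sum sum_nat_eq0 negb_forall.
by apply: eq_existsb => i; case: (A i j).
Qed.

Lemma lonesumP A :
  reflect (forall B, row_sum B =1 row_sum A -> col_sum B =1 col_sum A -> B = A)
    (lonesum A).
Proof.
apply: (iffP forallP) => [h B hr hc|h B].
  move/implyP: (h B) => hB; apply/eqP/hB/andP.
  by split; apply/forallP => i; apply/eqP.
apply/implyP => /andP[/forallP hr /forallP hc].
by apply/eqP/h => i; apply/eqP.
Qed.

End Supports.

Lemma row_sum_tr n k (A : 'M[bool]_(n, k)) : row_sum A^T =1 col_sum A.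
Proof. by move=> j; apply: eq_bigr => i _; rewrite mxE. Qed.

Lemma col_sum_tr n k (A : 'M[bool]_(n, k)) : col_sum A^T =1 row_sum A.
Proof. by move=> j; apply: eq_bigr => i _; rewrite mxE. Qed.

Lemma lonesum_tr n k (A : 'M[bool]_(n, k)) : lonesum A -> lonesum A^T.
Proof.
move/lonesumP => hA; apply/lonesumP => B hr hc.
rewrite -(hA B^T) ?trmxK // => i.
  by rewrite row_sum_tr hc col_sum_tr.
by rewrite col_sum_tr hr row_sum_tr.
Qed.

Lemma row_supp_tr n k (A : 'M[bool]_(n, k)) : row_supp A^T = col_supp A.
Proof. by apply/setP=> j; rewrite row_suppE col_suppE row_sum_tr. Qed.

(** * Full lines of lonesum matrices *)

(** Exchanging columns [j] and [j'] inside the rows [i] and [i'] preserves the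
    row sums; if [A i' j] were false, this would also be an exchange of the rows
    [i] and [i'] inside these two columns, and preserve the column sums. *)
Lemma lonesum_no_switch n k (A : 'M[bool]_(n, k)) i i' j j' :
  lonesum A -> A i j -> A i' j' -> ~~ A i j' -> A i' j.
Proof.
move/lonesumP => hA Aij Ai'j' NAij'; apply: contraT => NAi'j.
pose B := \matrix_(r, c)
  if r \in [:: i; i'] then A r (tperm j j' c) else A r c.
(* The same switch, seen as an exchange of rows. *)
have BE r c : B r c =
    if c \in [:: j; j'] then A (tperm i i' r) c else A r c.
  rewrite mxE !inE !permE /=; move: Aij Ai'j' NAij' NAi'j.
  case: (r =P i) => [->|_]; case: (_ =P i') => [->|_];
    case: (c =P j) => [->|_]; case: (_ =P j') => [->|_] //=;
    by do 4?case: (A _ _).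
have /(congr1 (fun M : 'M_(n, k) => M i j)) : B = A.
  apply: hA => [r|c].
    rewrite /row_sum; case ri: (r \in [:: i; i']); last first.
      by apply: eq_bigr => c _; rewrite mxE ri.
    rewrite [RHS](reindex_inj (@perm_inj _ (tperm j j'))).
    by apply: eq_bigr => c _; rewrite mxE ri.
  rewrite /col_sum; case cj: (c \in [:: j; j']); last first.
    by apply: eq_bigr => r _; rewrite BE cj.
  rewrite [RHS](reindex_inj (@perm_inj _ (tperm i i'))).
  by apply: eq_bigr => r _; rewrite BE cj.
by rewrite mxE mem_head tpermL Aij (negPf NAij').
Qed.

(** A row of largest sum contains every other row: were [j] missing from it, a
    row through [j] would contain it strictly by [lonesum_no_switch]. For
    [n = 0 < k] both sides are false, but for [n = k = 0] only the right-hand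
    side is. *)
Lemma lonesum_full_row n k (A : 'M[bool]_(n, k)) :
  lonesum A -> (0 < n + k)%N ->
  (col_supp A == [set: _]) = [exists i, forall j, A i j].
Proof.
move=> lA nk_gt0; apply/eqP/existsP => [cT|[i /forallP hi]]; last first.
  by apply/setP => j; rewrite !inE; apply/existsP; exists i.
have col_ex j : exists i, A i j.
  by move/setP/(_ j): cT; rewrite !inE => /existsP.
have [i0] : exists i : 'I_n, true.
  case: n k A lA cT col_ex nk_gt0 => [|n] [|k] A lA cT col_ex //= _.
  - by case: (col_ex ord0) => -[].
  - by exists ord0.
  - by exists ord0.
move=> _; case: (@arg_maxnP _ i0 xpredT (row_sum A) isT) => i _ imax.
exists i; apply/forallP => j; apply: contraT => NAij.
have [i' Ai'j] := col_ex j.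
have /negP[] : ~~ (row_sum A i' <= row_sum A i)%N; last by apply: imax.
have sub j' : A i j' -> A i' j'.
  by move=> Aij'; apply: (lonesum_no_switch lA Aij' Ai'j NAij).
rewrite -ltnNge /row_sum (bigD1 j) //= [X in (_ < X)%N](bigD1 j) //=.
rewrite Ai'j (negPf NAij) add0n add1n ltnS; apply: leq_sum => j' _.
by have := sub j'; case: (A i j') => // ->.
Qed.

Lemma lonesum_full_col n k (A : 'M[bool]_(n, k)) :
  lonesum A -> (0 < n + k)%N ->
  (row_supp A == [set: _]) = [exists j, forall i, A i j].
Proof.
move=> lA nk; rewrite -[A in row_supp A]trmxK row_supp_tr.
rewrite lonesum_full_row ?lonesum_tr //; last by rewrite addnC.
by apply: eq_existsb => j; apply: eq_forallb => i; rewrite mxE.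
Qed.

(** * Complementation and inclusion-exclusion *)

Definition compl_mx n k (A : 'M[bool]_(n, k)) := map_mx negb A.

Lemma compl_mxK n k : involutive (@compl_mx n k).
Proof. by move=> A; apply/matrixP => i j; rewrite !mxE negbK. Qed.

Lemma row_sum_compl n k (A : 'M[bool]_(n, k)) i :
  row_sum (compl_mx A) i = (k - row_sum A i)%N.
Proof.
have : (row_sum (compl_mx A) i + row_sum A i = k)%N.
  rewrite -big_split -[RHS]card_ord -sum1_card /=.
  by apply: eq_bigr => j _; rewrite mxE; case: (A i j).
by move=> e; rewrite -[X in (X - _)%N]e addnK.
Qed.

Lemma col_sum_compl n k (A : 'M[bool]_(n, k)) j :
  col_sum (compl_mx A) j = (n - col_sum A j)%N.
Proof. by rewrite -row_sum_tr map_trmx row_sum_compl row_sum_tr. Qed.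

Lemma lonesum_compl n k (A : 'M[bool]_(n, k)) :
  lonesum (compl_mx A) = lonesum A.
Proof.
have imp (B : 'M[bool]_(n, k)) : lonesum B -> lonesum (compl_mx B).
  move=> /lonesumP hB; apply/lonesumP => C hr hc.
  rewrite -(hB (compl_mx C)) ?compl_mxK // => i.
    by rewrite row_sum_compl hr -row_sum_compl compl_mxK.
  by rewrite col_sum_compl hc -col_sum_compl compl_mxK.
by apply/idP/idP => [/imp|/imp //]; rewrite compl_mxK.
Qed.

(** Complementation is the bijection: zero rows and columns become full ones,
    which by [lonesum_full_row] and [lonesum_full_col] are the obstructions to
    zero columns and rows. *)
Lemma card_lonesum_zero_row_col n k : (0 < n + k)%N ->
  #|[set A : 'M[bool]_(n, k) | [&& lonesum A, row_supp A != [set: _]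
     & col_supp A != [set: _]]]| = D n k.
Proof.
move=> nk; rewrite /D -(card_imset _ (can_inj (@compl_mxK n k))).
apply: eq_card => A; apply/idP/idP.
  case/imsetP => B; rewrite inE => /and3P[lB rB cB] ->.
  rewrite inE lonesum_compl lB no_zero_lineE /=.
  rewrite lonesum_full_row ?lonesum_full_col ?lonesum_compl //.
  apply/andP; split; apply/existsP.
    have /subsetPn[] : ~~ ([set: 'I_k] \subset col_supp B) by rewrite subTset.
    move=> j _; rewrite inE negb_exists => /forallP h.
    by exists j; apply/forallP => i; rewrite mxE.
  have /subsetPn[] : ~~ ([set: 'I_n] \subset row_supp B) by rewrite subTset.
  move=> j _; rewrite inE negb_exists => /forallP h.
  by exists j; apply/forallP => i; rewrite mxE.
rewrite inE no_zero_lineE => /and3P[lA].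
rewrite lonesum_full_row ?lonesum_full_col //.
case/existsP => j /forallP hj /existsP[i /forallP hi].
apply/imsetP; exists (compl_mx A); last by rewrite compl_mxK.
rewrite inE lonesum_compl lA /=; apply/andP; split.
  apply/eqP => /setP/(_ i); rewrite !inE => /existsP[j'].
  by rewrite mxE hi.
apply/eqP => /setP/(_ j); rewrite !inE => /existsP[j'].
by rewrite mxE hj.
Qed.

(** The matrices with no zero line, which form the intersection of the two
    families, cancel against those outside their union, which have zero lines in
    both directions; the exception is [n = k = 0]. *)
Lemma lonesum_inclusion_exclusion n k :
  (#|[set A : 'M[bool]_(n, k) | lonesum A & row_supp A == [set: _]]|
   + #|[set A : 'M[bool]_(n, k) | lonesum A & col_supp A == [set: _]]|
   = #|[set A : 'M[bool]_(n, k) | lonesum A]| + (n + k == 0))%N.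
Proof.
set LR := [set A | _ & row_supp A == _].
set LC := [set A | _ & col_supp A == _].
set L := [set A | lonesum A].
have DE : D n k = #|LR :&: LC|.
  by apply: eq_card => A; rewrite !inE no_zero_lineE; case: (lonesum A).
rewrite -cardsUI -DE -(cardsID (LR :|: LC) L).
have -> : L :&: (LR :|: LC) = LR :|: LC.
  by apply/setIidPr/subsetP => A; rewrite !inE; case: (lonesum A).
rewrite -addnA; congr (_ + _)%N.
have -> : L :\: (LR :|: LC) = [set A : 'M[bool]_(n, k) |
    [&& lonesum A, row_supp A != [set: _] & col_supp A != [set: _]]].
  apply/setP => A; rewrite !inE andbC.
  by case: (lonesum A); rewrite //= negb_or.
have [nk0|nk_gt0] := posnP (n + k); last first.
  by rewrite card_lonesum_zero_row_col // addn0.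
have [n0 k0] : n = 0%N /\ k = 0%N by lia.
rewrite {L LR LC DE nk0}n0 k0 /= (_ : [set A | _] = set0); last first.
  apply/setP => A; rewrite !inE; apply/and3P => -[_ /eqP[]].
  by apply/setP => -[].
rewrite cards0 -(card1 (0 : 'M[bool]_(0, 0))); apply: eq_card => A.
rewrite !inE [A]flatmx0 eqxx no_zero_lineE; apply/and3P; split.
- by apply/lonesumP => B _ _; rewrite [B]flatmx0.
- by apply/eqP/setP => -[].
- by apply/eqP/setP => -[].
Qed.

(** * Insertion of zero rows and columns *)

Lemma sum_codom p q (h : 'I_p -> 'I_q) (F : 'I_q -> nat) : injective h ->
  (forall j, j \notin codom h -> F j = 0%N) ->
  (\sum_j F j = \sum_j F (h j))%N.
Proof.
move=> h_inj F0; rewrite (bigID [in codom h]) /= [X in (_ + X)%N]big1 // addn0.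
by rewrite -big_uniq ?big_image // map_inj_uniq ?enum_uniq.
Qed.

Section Extension.
Variables (m l n k : nat) (f : 'I_m -> 'I_n) (g : 'I_l -> 'I_k).
Hypotheses (f_inj : injective f) (g_inj : injective g).

(** A disjunction over preimages, of which there is at most one, spares a choice
    of partial inverses of [f] and [g]. *)
Definition ext_mx (B : 'M[bool]_(m, l)) : 'M[bool]_(n, k) :=
  \matrix_(i, j) [exists i', exists j', [&& f i' == i, g j' == j & B i' j']].

Lemma ext_mxE B i j : ext_mx B (f i) (g j) = B i j.
Proof.
rewrite mxE; apply/existsP/idP => [[i' /existsP[j']]|Bij].
  by case/and3P => /eqP/f_inj-> /eqP/g_inj->.
by exists i; apply/existsP; exists j; rewrite !eqxx.
Qed.

Lemma ext_mx_out B i j : ext_mx B i j -> i \in codom f /\ j \in codom g.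
Proof.
rewrite mxE => /existsP[i' /existsP[j' /and3P[/eqP<- /eqP<- _]]].
by split; apply: codom_f.
Qed.

Lemma ext_mxK : cancel ext_mx (mxsub f g).
Proof. by move=> B; apply/matrixP => i j; rewrite mxE ext_mxE. Qed.

Lemma mxsub_extK A : {subset row_supp A <= codom f} ->
  {subset col_supp A <= codom g} -> ext_mx (mxsub f g A) = A.
Proof.
move=> rA cA; apply/matrixP => i j; apply/idP/idP => [E|Aij].
  have [/codomP[i' ei] /codomP[j' ej]] := ext_mx_out E.
  by move: E; rewrite ei ej ext_mxE mxE.
have /codomP[i' ei] : i \in codom f.
  by apply: rA; rewrite inE; apply/existsP; exists j.
have /codomP[j' ej] : j \in codom g.
  by apply: cA; rewrite inE; apply/existsP; exists i.
by rewrite ei ej ext_mxE mxE -ei -ej.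
Qed.

Lemma row_sum_ext B i : row_sum (ext_mx B) (f i) = row_sum B i.
Proof.
rewrite /row_sum (sum_codom g_inj) => [|j].
  by apply: eq_bigr => j _; rewrite ext_mxE.
by apply: contraNeq; rewrite eqb0 negbK => /ext_mx_out[].
Qed.

Lemma col_sum_ext B j : col_sum (ext_mx B) (g j) = col_sum B j.
Proof.
rewrite /col_sum (sum_codom f_inj) => [|i].
  by apply: eq_bigr => i _; rewrite ext_mxE.
by apply: contraNeq; rewrite eqb0 negbK => /ext_mx_out[].
Qed.

Lemma row_supp_ext B : row_supp (ext_mx B) = f @: row_supp B.
Proof.
apply/setP => i; apply/idP/imsetP => [|[i' + ->]]; last first.
  by rewrite !row_suppE row_sum_ext.
move=> Ei; have /codomP[i' ei] : i \in codom f.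
  by move: Ei; rewrite inE => /existsP[j /ext_mx_out[]].
by exists i'; rewrite // row_suppE -row_sum_ext -ei -row_suppE.
Qed.

Lemma col_supp_ext B : col_supp (ext_mx B) = g @: col_supp B.
Proof.
apply/setP => j; apply/idP/imsetP => [|[j' + ->]]; last first.
  by rewrite !col_suppE col_sum_ext.
move=> Ej; have /codomP[j' ej] : j \in codom g.
  by move: Ej; rewrite inE => /existsP[i /ext_mx_out[]].
by exists j'; rewrite // col_suppE -col_sum_ext -ej -col_suppE.
Qed.

(** A competitor of an extension has the same supports, hence is itself an
    extension, and extension is compatible with line sums. *)
Lemma lonesum_ext B : lonesum (ext_mx B) = lonesum B.
Proof.
apply/lonesumP/lonesumP => [hE C hr hc|hB C hr hc].
  apply: (can_inj ext_mxK); apply: hE => [i|j].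
    have [/codomP[i' ->]|Ni] := boolP (i \in codom f).
      by rewrite !row_sum_ext.
    by rewrite /row_sum !big1 // => j _; apply/eqP;
       rewrite eqb0; apply: contra Ni => /ext_mx_out[].
  have [/codomP[j' ->]|Nj] := boolP (j \in codom g).
    by rewrite !col_sum_ext.
  by rewrite /col_sum !big1 // => i _; apply/eqP;
     rewrite eqb0; apply: contra Nj => /ext_mx_out[].
have rC : row_supp C = f @: row_supp B.
  by rewrite -row_supp_ext; apply/setP => i; rewrite !row_suppE hr.
have cC : col_supp C = g @: col_supp B.
  by rewrite -col_supp_ext; apply/setP => j; rewrite !col_suppE hc.
have CE : ext_mx (mxsub f g C) = C.
  apply: mxsub_extK => i; rewrite ?rC ?cC => /imsetP[i' _ ->];
    exact: codom_f.
rewrite -CE; congr ext_mx; apply: hB => [i|j].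
  by rewrite -row_sum_ext CE hr row_sum_ext.
by rewrite -col_sum_ext CE hc col_sum_ext.
Qed.

End Extension.

(** * Counting lonesum matrices by supports *)

Lemma enum_val_imset (T : finType) (S : {set T}) :
  enum_val @: [set: 'I_#|S|] = S.
Proof.
apply/setP => x; apply/imsetP/idP => [[i _ ->]|Sx]; first exact: enum_valP.
by exists (enum_rank_in Sx x); rewrite ?inE ?enum_rankK_in.
Qed.

(** Extension along the enumerations of [R] and [C] is a bijection from the
    lonesum matrices of size [#|R| x #|C|] with no zero line. *)
Lemma card_lonesum_supp n k (R : {set 'I_n}) (C : {set 'I_k}) :
  #|[set A : 'M[bool]_(n, k) |
      [&& lonesum A, row_supp A == R & col_supp A == C]]| = D #|R| #|C|.
Proof.
pose f := @enum_val _ (mem R); pose g := @enum_val _ (mem C).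
have f_inj : injective f := @enum_val_inj _ _.
have g_inj : injective g := @enum_val_inj _ _.
rewrite /D -(card_imset _ (can_inj (ext_mxK f_inj g_inj))).
apply: eq_card => A; apply/idP/imsetP => [|[B + ->]]; last first.
  rewrite !inE no_zero_lineE lonesum_ext // row_supp_ext // col_supp_ext //.
  case/and3P => -> /eqP -> /eqP ->; rewrite /f /g.
  by rewrite !enum_val_imset !eqxx.
rewrite inE => /and3P[lA /eqP rA /eqP cA].
have AE : ext_mx f g (mxsub f g A) = A.
  apply: mxsub_extK => //.
    move=> i; rewrite rA -{1}[R]enum_val_imset => /imsetP[i' _ ->].
    exact: codom_f.
  move=> j; rewrite cA -{1}[C]enum_val_imset => /imsetP[j' _ ->].
  exact: codom_f.
exists (mxsub f g A); rewrite ?AE // inE no_zero_lineE.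
rewrite -(lonesum_ext f_inj g_inj) AE lA /=; apply/andP; split; apply/eqP.
  apply: (imset_inj f_inj).
  by rewrite -(row_supp_ext f_inj g_inj) AE rA enum_val_imset.
apply: (imset_inj g_inj).
by rewrite -(col_supp_ext f_inj g_inj) AE cA enum_val_imset.
Qed.

Lemma sum_set_card n (F : nat -> nat) :
  (\sum_(S : {set 'I_n}) F #|S| = \sum_(i < n.+1) 'C(n, i) * F i)%N.
Proof.
rewrite (partition_big (fun S : {set 'I_n} => inord #|S| : 'I_n.+1) xpredT) //=.
apply: eq_bigr => i _.
have -> : 'C(n, i) = #|[set S : {set 'I_n} | #|S| == i]|.
  by rewrite card_draws card_ord.
have le_n (S : {set 'I_n}) : (#|S| < n.+1)%N.
  by rewrite ltnS -[X in (_ <= X)%N](card_ord n) max_card.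
rewrite -sum1_card big_distrl /=; apply: eq_big => [S|S /eqP <-].
  by rewrite inE -val_eqE /= inordK.
by rewrite mul1n inordK.
Qed.

Lemma card_lonesum_no_zero_row n k :
  (#|[set A : 'M[bool]_(n, k) | lonesum A & row_supp A == [set: _]]|
   = \sum_(j < k.+1) 'C(k, j) * D n j)%N.
Proof.
rewrite -(sum_set_card _ (D n)) -sum1_card.
rewrite (partition_big (@col_supp n k) xpredT) //=.
apply: eq_bigr => C _; rewrite -[n in D n]card_ord -cardsT -card_lonesum_supp.
by rewrite -sum1_card; apply: eq_bigl => A; rewrite !inE andbA.
Qed.

Lemma card_lonesum_no_zero_col n k :
  (#|[set A : 'M[bool]_(n, k) | lonesum A & col_supp A == [set: _]]|
   = \sum_(i < n.+1) 'C(n, i) * D i k)%N.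
Proof.
rewrite -(sum_set_card _ (D^~ k)) -sum1_card.
rewrite (partition_big (@row_supp n k) xpredT) //=.
apply: eq_bigr => R _; rewrite -[k in D _ k]card_ord -cardsT -card_lonesum_supp.
rewrite -sum1_card; apply: eq_bigl => A.
by rewrite !inE -andbA [X in _ && X]andbC.
Qed.

Lemma card_lonesum n k :
  (#|[set A : 'M[bool]_(n, k) | lonesum A]|
   = \sum_(i < n.+1) \sum_(j < k.+1) 'C(n, i) * ('C(k, j) * D i j))%N.
Proof.
under eq_bigr do rewrite -big_distrr /= -sum_set_card.
rewrite -(sum_set_card _ (fun i => \sum_(S : {set 'I_k}) D i #|S|)%N).
rewrite -sum1_card.
rewrite (partition_big (@row_supp n k) xpredT) //=.
apply: eq_bigr => R _; rewrite (partition_big (@col_supp n k) xpredT) //=.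
apply: eq_bigr => C _; rewrite -card_lonesum_supp.
by rewrite -sum1_card; apply: eq_bigl => A; rewrite !inE andbA.
Qed.

(** * Coefficients of bivariate series *)

Lemma coefs_sum (R : zmodType) (I : Type) (r : seq I) (P : pred I)
    (F : I -> fps R) m :
  coefs (\sum_(i <- r | P i) F i) m = \sum_(i <- r | P i) coefs (F i) m.
Proof. by elim/big_rec2: _ => // i y f _ <-. Qed.

Lemma coef2M F G n k :
  coef2 (F * G) n k =
  \sum_(i < n.+1) \sum_(j < k.+1) coef2 F i j * coef2 G (n - i) (k - j).
Proof. by rewrite /coef2 coef_fpsM coefs_sum; apply: eq_bigr. Qed.

Lemma coef2_ext F G : coef2 F =2 coef2 G -> F = G.
Proof. by move=> FG; apply: fpsP => n; apply: fpsP => k; apply: FG. Qed.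

Lemma coef2_monomialM p q F n k :
  coef2 (fps2_of (fun i j => ((i == p) && (j == q))%:R) * F) n k =
  if (p <= n)%N && (q <= k)%N then coef2 F (n - p) (k - q) else 0.
Proof.
rewrite coef2M; case: (leqP p n) => [lepn|ltnp] /=; last first.
  rewrite big1 // => i _; rewrite big1 // => j _.
  by rewrite /coef2 /= ltn_eqF ?mul0r // (leq_trans _ ltnp).
rewrite (bigD1 (Ordinal (lepn : (p < n.+1)%N))) //= [X in _ + X]big1 => [|i].
  rewrite addr0; case: (leqP q k) => [leqk|ltkq]; last first.
    rewrite big1 // => j _; rewrite /coef2 /= (_ : (j == q :> nat) = false).
      by rewrite andbF mul0r.
    by rewrite ltn_eqF // (leq_ltn_trans (leq_ord j)).
  rewrite (bigD1 (Ordinal (leqk : (q < k.+1)%N))) //= [X in _ + X]big1 => [|j].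
    by rewrite addr0 /coef2 /= !eqxx mul1r.
  by rewrite -val_eqE /coef2 /= => /negPf->; rewrite andbF mul0r.
rewrite -val_eqE /= => /negPf ip; rewrite big1 // => j _.
by rewrite /coef2 /= ip mul0r.
Qed.

Lemma coef2_expX m n k : coef2 (fpsX ^+ m) n k = ((n == m) && (k == 0%N))%:R.
Proof.
elim: m n => [|m IHm] n; first by rewrite expr0 coef2_1.
rewrite exprS coef2_monomialM subn0 andbT; case: n => [|n] //=.
by rewrite subn1 /= IHm.
Qed.

Lemma coef2_expY m n k : coef2 (fpsY ^+ m) n k = ((n == 0%N) && (k == m))%:R.
Proof.
elim: m k => [|m IHm] k; first by rewrite expr0 coef2_1.
rewrite exprS coef2_monomialM subn0 /=; case: k => [|k] /=.
  by rewrite andbF.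
by rewrite subn1 /= IHm.
Qed.

(** Multiplication by [x] and [y] shifts the coefficients, so that induction on
    [m] reduces the binomial theorem to Pascal's rule. *)
Lemma coef2_expXY m n k :
  coef2 ((fpsX + fpsY) ^+ m) n k = ((n + k == m) * 'C(m, n))%N%:R.
Proof.
elim: m n k => [|m IHm] n k.
  by rewrite expr0 coef2_1 addn_eq0; case: n => [|n]; rewrite ?bin0 ?muln1.
rewrite exprS mulrDl coef2D !coef2_monomialM !subn0 !subn1 /= andbT.
case: n k => [|n] [|k] //=; rewrite ?IHm.
- by rewrite add0r !bin0 !add0n eqSS.
- by rewrite addr0 !addn0 eqSS; case: eqP => [->|]; rewrite ?binn // !mul0n.
by rewrite -natrD binS !addSn -addnS eqSS -mulnDr [('C(m, n) + _)%N]addnC.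
Qed.

(** * Exponential generating functions *)

Lemma coef2_fps_expX n k : coef2 (fps_exp fpsX) n k = (k == 0%N)%:R / n`!%:R.
Proof.
rewrite [LHS]/coef2 /= (bigD1 (inord n)) //= inordK ?ltnS ?leq_addr //.
rewrite coef2_expX eqxx big1 ?addr0 // => i.
rewrite -val_eqE /= inordK ?ltnS ?leq_addr // coef2_expX eq_sym => /negPf->.
by rewrite mul0r.
Qed.

Lemma coef2_fps_expY n k : coef2 (fps_exp fpsY) n k = (n == 0%N)%:R / k`!%:R.
Proof.
rewrite [LHS]/coef2 /= (bigD1 (inord k)) //= inordK ?ltnS ?leq_addl //.
rewrite coef2_expY eqxx andbT big1 ?addr0 // => i.
rewrite -val_eqE /= inordK ?ltnS ?leq_addl // coef2_expY eq_sym => /negPf->.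
by rewrite andbF mul0r.
Qed.

Lemma natr_fact_neq0 n : n`!%:R != 0 :> rat.
Proof. by rewrite Num.Theory.pnatr_eq0 -lt0n fact_gt0. Qed.

(** Only the power [m = n + k], the last one of the truncated sum, contributes,
    with [C(n + k, n) / (n + k)! = 1 / (n! k!)]. *)
Lemma coef2_fps_expXY n k :
  coef2 (fps_exp (fpsX + fpsY)) n k = (n`!%:R * k`!%:R)^-1.
Proof.
rewrite [LHS]/coef2 /= big_ord_recr /= big1 ?add0r => [|i _]; last first.
  by rewrite coef2_expXY gtn_eqF // mul0r.
rewrite coef2_expXY eqxx mul1n -(@bin_fact (n + k) n) ?leq_addr //.
rewrite addKn !natrM; field.
by rewrite !natr_fact_neq0 Num.Theory.pnatr_eq0 -lt0n bin_gt0 leq_addr.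
Qed.

Lemma natr_bin n i : (i <= n)%N ->
  ('C(n, i)%:R : rat) = n`!%:R / (i`!%:R * (n - i)`!%:R).
Proof.
by move=> lein; rewrite -(bin_fact lein) !natrM; field; rewrite !natr_fact_neq0.
Qed.

Lemma egf2M_expX a n k : coef2 (egf2 a * fps_exp fpsX) n k =
  (\sum_(i < n.+1) 'C(n, i) * a i k)%N%:R / (n`!%:R * k`!%:R).
Proof.
rewrite coef2M natr_sum mulr_suml; apply: eq_bigr => i _.
rewrite big_ord_recr /= subnn big1 ?add0r => [|j _]; last first.
  by rewrite coef2_fps_expX subn_eq0 leqNgt ltn_ord mul0r mulr0.
rewrite coef2_fps_expX /coef2 /= natrM natr_bin ?leq_ord //.
by field; rewrite !natr_fact_neq0.
Qed.

Lemma egf2M_expY a n k : coef2 (egf2 a * fps_exp fpsY) n k =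
  (\sum_(j < k.+1) 'C(k, j) * a n j)%N%:R / (n`!%:R * k`!%:R).
Proof.
rewrite coef2M big_ord_recr /= subnn big1 ?add0r => [|i _]; last first.
  by rewrite big1 // => j _;
    rewrite coef2_fps_expY subn_eq0 leqNgt ltn_ord mul0r mulr0.
rewrite natr_sum mulr_suml; apply: eq_bigr => j _.
rewrite coef2_fps_expY /coef2 /= natrM natr_bin ?leq_ord //.
by field; rewrite !natr_fact_neq0.
Qed.

Lemma egf2M_expXY a n k : coef2 (egf2 a * fps_exp (fpsX + fpsY)) n k =
  (\sum_(i < n.+1) \sum_(j < k.+1) 'C(n, i) * ('C(k, j) * a i j))%N%:R
    / (n`!%:R * k`!%:R).
Proof.
rewrite coef2M natr_sum mulr_suml; apply: eq_bigr => i _.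
rewrite natr_sum mulr_suml; apply: eq_bigr => j _.
rewrite coef2_fps_expXY /coef2 /= !natrM !natr_bin ?leq_ord //.
by field; rewrite !natr_fact_neq0.
Qed.

Lemma coef2_egf2M_denominator a n k :
  coef2 (egf2 a * (fps_exp fpsX + fps_exp fpsY - fps_exp (fpsX + fpsY))) n k =
  ((\sum_(i < n.+1) 'C(n, i) * a i k)%N%:R
   + (\sum_(j < k.+1) 'C(k, j) * a n j)%N%:R
   - (\sum_(i < n.+1) \sum_(j < k.+1) 'C(n, i) * ('C(k, j) * a i j))%N%:R)
    / (n`!%:R * k`!%:R).
Proof.
rewrite mulrBr mulrDr coef2D coef2N coef2D mulrBl mulrDl.
(* Pairing each product with its formula by [congr] avoids the unification of
   distinct exponentials, which a rewrite would attempt by unfolding them. *)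
congr (_ + _ - _).
- exact: egf2M_expX.
- exact: egf2M_expY.
- exact: egf2M_expXY.
Qed.

Theorem theorem3 :
  egf2 D = 1 / (fps_exp fpsX + fps_exp fpsY - fps_exp (fpsX + fpsY)).
Proof.
apply: (canRL (mulrK denominator_unit)); apply: coef2_ext => n k.
rewrite coef2_egf2M_denominator coef2_1.
rewrite -card_lonesum_no_zero_row -card_lonesum_no_zero_col -card_lonesum.
rewrite -natrD addnC lonesum_inclusion_exclusion natrD addrAC subrr add0r.
rewrite addn_eq0.
by case: n k => [|n] [|k]; rewrite ?mul0r // !fact0 mulr1 divr1.
Qed.
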